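(* Let $d \geq 1$ and $\Delta_d := \{(a_0, a_1, \dots, a_d) \in \mathbb{R}^{d+1} : a_0 < a_1 < \dots < a_d\}$. The map $(a_0, a_1, \dots, a_d) \mapsto \mathcal{G}(\{a_0, a_1, \dots, a_d\})$ is continuous on $\Delta_d$.
   Context: An alphabet is a finite set $A=\{a_0,\dots,a_d\}$ of reals with $a_0<a_1<\dots<a_d$. For $\beta>1$ and $x\in\mathbb{R}$, a sequence $(u_k)_{k\ge1}\in A^{\mathbb{N}}$ is a $\beta$-expansion of $x$ over $A$ if $x=\sum_{k\ge1}u_k\beta^{-k}$. The univoque set $\mathcal{U}_\beta(A)$ is the set of sequences $(u_k)\in A^{\mathbb{N}}$ such that $\sum_k u_k\beta^{-k}$ has a unique $\beta$-expansion over $A$; it always contains the constant sequences $\overline{a_0}$ and $\overline{a_d}$ (here $\overline{w}$ denotes the infinite periodic word with period $w$). The generalised golden ratio $\mathcal{G}(A)\in(1,\infty)$ is the (known to exist, unique) number such that $\mathcal{U}_\beta(A)=\{\overline{a_0},\overline{a_d}\}$ for all $\beta\in(1,\mathcal{G}(A))$, while $\mathcal{U}_\beta(A)$ contains some other element for every $\beta>\mathcal{G}(A)$. *)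

(* Defs.v *)
From HB Require Import structures.
From mathcomp Require Import all_boot all_order all_algebra.
From mathcomp Require Import all_classical all_reals all_analysis.
Set Implicit Arguments.
Unset Strict Implicit.
Unset Printing Implicit Defensive.
Import Order.TTheory GRing.Theory Num.Theory.
Import numFieldNormedType.Exports.
Local Open Scope classical_set_scope.
Local Open Scope ring_scope.

(* Sequences are indexed from 0: u k is the (k+1)-st digit, of weight
   beta ^- k.+1. *)
Definition expansions (R : realType) (beta : R) (A : set R) (x : R) :
    set (nat -> R) :=
  [set u | (forall k, A (u k)) /\
           series (fun k => u k * beta ^- k.+1) @ \oo --> x].

Definition univoque (R : realType) (beta : R) (A : set R) : set (nat -> R) :=
  [set u | exists x, expansions beta A x = [set u]].

Definition Delta (R : realType) (d : nat) : set 'rV[R]_d.+1 :=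
  [set a | forall i j : 'I_d.+1, (i < j)%N -> a ord0 i < a ord0 j].

Definition alphabet (R : realType) (d : nat) (a : 'rV[R]_d.+1) : set R :=
  range (fun i : 'I_d.+1 => a ord0 i).

Definition trivial_seqs (R : realType) (d : nat) (a : 'rV[R]_d.+1) :
    set (nat -> R) :=
  [set cst (a ord0 ord0); cst (a ord0 ord_max)].

Definition is_golden_ratio (R : realType) (d : nat) (a : 'rV[R]_d.+1) (g : R) :
    Prop :=
  [/\ 1 < g,
      forall beta, 1 < beta -> beta < g ->
        univoque beta (alphabet a) = trivial_seqs a
    & forall beta, g < beta ->
        exists2 u, univoque beta (alphabet a) u & ~ trivial_seqs a u].

(* Definite description: for a in Delta with d >= 1 exactly one g satisfies
   the predicate; the default value 0 is only relevant outside that domain. *)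
Definition golden_ratio (R : realType) (d : nat) (a : 'rV[R]_d.+1) : R :=
  xget 0 [set g | is_golden_ratio a g].

(* Main.v *)
(* Call a sequence of digit indices [s] admissible for [a] and [beta] if, whenever
   [s k] can be raised (lowered) to [j], the remaining tail measured from [a_0]
   (from [a_d]) is strictly smaller than the gap between the digits [s k] and [j].
   Admissible sequences are always univoque. If no nontrivial one exists, then
   no gap exceeds (a_d - a_0) / (beta - 1), the greedy algorithm expands every
   point of [a_0 / (beta - 1), a_d / (beta - 1)], and so every univoque sequence
   is admissible, hence trivial. Thus G(a) is the infimum of the [beta] that have
   a nontrivial admissible sequence. If all gaps of [a] and [b] agree up to a
   factor [t], then a sequence admissible for [a] and [beta] is admissible for
   [b] and [t ^ 2 * beta]; hence G(b) <= t ^ 2 * G(a) and conversely. *)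
Require Import Defs.
From HB Require Import structures.
From mathcomp Require Import all_boot all_order all_algebra.
From mathcomp Require Import all_classical all_reals all_analysis.
From mathcomp Require Import ring lra.
Set Implicit Arguments.
Unset Strict Implicit.
Unset Printing Implicit Defensive.
Import Order.TTheory GRing.Theory Num.Theory.
Import numFieldNormedType.Exports.
Local Open Scope classical_set_scope.
Local Open Scope ring_scope.

(** * Values of bounded sequences in base [beta] *)

Definition bsum {R : realType} (beta : R) (w : nat -> R) : R :=
  limn (series (fun k => w k * beta ^- k.+1)).

Definition bounded_seq {R : realType} (w : nat -> R) : Prop :=
  exists M : R, forall k, `|w k| <= M.

Definition tail {T : Type} (n : nat) (w : nat -> T) : nat -> T :=
  fun i => w (n + i)%N.

Lemma bounded_seq_tail (R : realType) (w : nat -> R) n :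
  bounded_seq w -> bounded_seq (tail n w).
Proof. by case=> M Mw; exists M => k; exact: Mw. Qed.

Lemma bounded_seqB (R : realType) (v w : nat -> R) :
  bounded_seq v -> bounded_seq w -> bounded_seq (fun k => v k - w k).
Proof.
move=> [M Mv] [N Nw]; exists (M + N) => k.
by rewrite (le_trans (ler_normB _ _))// lerD.
Qed.

Lemma bounded_seq_cst (R : realType) (c : R) : bounded_seq (fun=> c).
Proof. by exists `|c|. Qed.

Lemma normV_lt1 (R : realType) (beta : R) : 1 < beta -> `|beta^-1| < 1.
Proof. by move=> b1; rewrite ger0_norm ?invr_ge0 ?invf_lt1; lra. Qed.

Lemma cvg_bsum (R : realType) (beta : R) (w : nat -> R) :
  1 < beta -> bounded_seq w ->
  cvgn (series (fun k => w k * beta ^- k.+1)).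
Proof.
move=> b1 [M Mw]; apply: (@normed_cvg R R).
have M0 : 0 <= M by exact: le_trans (Mw 0%N).
apply: (@series_le_cvg _ _ (geometric (M * beta^-1) beta^-1)) => [n|n|n|].
- exact: normr_ge0.
- by rewrite geometric_ge0// ?mulr_ge0 ?invr_ge0//; lra.
- rewrite /= normrM [`|beta ^- _|]ger0_norm; last first.
    by rewrite invr_ge0 exprn_ge0//; lra.
  by rewrite -mulrA -exprS exprVn ler_wpM2r// invr_ge0 exprn_ge0//; lra.
- exact/is_cvg_geometric_series/normV_lt1.
Qed.

(* A bounded orbit of [y |-> beta * y - digit] spells an expansion of its
   initial point. *)
Lemma cvg_bsum_orbit (R : realType) (beta : R) (w y : nat -> R) :
  1 < beta -> bounded_seq y -> (forall n, y n.+1 = beta * y n - w n) ->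
  series (fun k => w k * beta ^- k.+1) @ \oo --> y 0%N.
Proof.
move=> b1 [M My] yS.
have b0 : beta != 0 by rewrite gt_eqF//; lra.
(* The recursion telescopes: after n digits the missing part is exactly [y n * beta ^- n]. *)
have seriesE : series (fun k => w k * beta ^- k.+1) =
    (fun n => y 0%N - y n * beta ^- n).
  apply/funext; elim=> [|n IHn]; rewrite /series/=.
    by rewrite big_geq// expr0 invr1 mulr1 subrr.
  rewrite big_nat_recr//= [X in X + _]IHn yS exprS.
  by field; rewrite b0 expf_neq0.
rewrite seriesE -[X in _ --> X]subr0; apply: cvgB; first exact: cvg_cst.
apply/norm_cvg0P.
apply: (@squeeze_cvgr _ _ _ _ (cst 0) (geometric M beta^-1)).
- apply: nearW => n; rewrite normr_ge0/= normrM exprVn.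
  by rewrite [`|beta ^- _|]ger0_norm ?ler_wpM2r ?invr_ge0 ?exprn_ge0//; lra.
- exact: cvg_cst.
- exact/cvg_geometric/normV_lt1.
Qed.

Lemma bsum_orbit (R : realType) (beta : R) (w y : nat -> R) :
  1 < beta -> bounded_seq y -> (forall n, y n.+1 = beta * y n - w n) ->
  bsum beta w = y 0%N.
Proof. by move=> b1 by_ yS; apply/cvg_lim => //; exact: cvg_bsum_orbit. Qed.

Lemma bsum_cst (R : realType) (beta c : R) :
  1 < beta -> bsum beta (fun=> c) = c / (beta - 1).
Proof.
(* [c / (beta - 1)] is the fixed point of y |-> beta y - c, so the orbit is constant. *)
move=> b1; apply: (@bsum_orbit _ _ _ (fun=> c / (beta - 1))) => //.
  exact: bounded_seq_cst.
by move=> _; field; rewrite subr_eq0 gt_eqF.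
Qed.

(** Two bases are allowed because a change of alphabet is paid for by a change of base. *)
Lemma ler_bsum (R : realType) (beta gamma : R) (v w : nat -> R) :
  1 < beta -> 1 < gamma -> bounded_seq v -> bounded_seq w ->
  (forall k, v k * beta ^- k.+1 <= w k * gamma ^- k.+1) ->
  bsum beta v <= bsum gamma w.
Proof. by move=> b1 g1 bv bw vw; apply: lim_series_le => //; exact: cvg_bsum. Qed.

Lemma ler_bsum2 (R : realType) (beta : R) (v w : nat -> R) :
  1 < beta -> bounded_seq v -> bounded_seq w -> (forall k, v k <= w k) ->
  bsum beta v <= bsum beta w.
Proof.
move=> b1 bv bw vw; apply: ler_bsum => // k.
by rewrite ler_wpM2r// invr_ge0 exprn_ge0//; lra.
Qed.

Lemma bsumB (R : realType) (beta : R) (v w : nat -> R) :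
  1 < beta -> bounded_seq v -> bounded_seq w ->
  bsum beta (fun k => v k - w k) = bsum beta v - bsum beta w.
Proof.
move=> b1 bv bw; rewrite /bsum -lim_seriesB; try exact: cvg_bsum.
by congr (limn (series _)); apply/funext => k; rewrite mulrBl.
Qed.

Lemma bsumZ (R : realType) (beta c : R) (w : nat -> R) :
  1 < beta -> bounded_seq w ->
  bsum beta (fun k => c * w k) = c * bsum beta w.
Proof.
move=> b1 bw; rewrite /bsum -[RHS]lim_seriesZ; last exact: cvg_bsum.
by congr (limn (series _)); apply/funext => k; rewrite -mulrA.
Qed.

Lemma bsum_rec (R : realType) (beta : R) (w : nat -> R) n :
  1 < beta -> bounded_seq w ->
  beta * bsum beta (tail n w) = w n + bsum beta (tail n.+1 w).
Proof.
move=> b1 bw; have b0 : beta != 0 by rewrite gt_eqF//; lra.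
suff -> : bsum beta (tail n w) = (w n + bsum beta (tail n.+1 w)) / beta.
  by field.
apply/cvg_lim => //; rewrite -cvg_shiftS.
have -> : [sequence series (fun k => tail n w k * beta ^- k.+1) m.+1]_m =
    (fun m => (w n + series (fun k => tail n.+1 w k * beta ^- k.+1) m) / beta).
  apply/funext => m; rewrite /series/= big_nat_recl// /tail addn0 expr1.
  rewrite mulrDl; congr (_ + _); rewrite mulr_suml; apply: eq_bigr => i _.
  by rewrite addSnnS [beta ^+ i.+2]exprSr invfM mulrA.
apply: cvgMl; apply: cvgD; first exact: cvg_cst.
by apply: cvg_bsum => //; exact: bounded_seq_tail.
Qed.

(** * Digit sequences and admissibility *)

Definition digits {R : realType} {d : nat} (a : 'rV[R]_d.+1)
  (s : nat -> 'I_d.+1) : nat -> R := fun k => a ord0 (s k).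

(* Stated on digit indices, so that one sequence can be read over several
   alphabets. *)
Definition admissible {R : realType} {d : nat} (a : 'rV[R]_d.+1) (beta : R)
    (s : nat -> 'I_d.+1) : Prop :=
  forall (k : nat) (j : 'I_d.+1),
    ((s k < j)%N -> bsum beta (fun i => tail k.+1 (digits a s) i - a ord0 ord0)
                    < a ord0 j - a ord0 (s k)) /\
    ((j < s k)%N -> bsum beta (fun i => a ord0 ord_max - tail k.+1 (digits a s) i)
                    < a ord0 (s k) - a ord0 j).

Definition nontrivial {d : nat} (s : nat -> 'I_d.+1) : Prop :=
  s <> cst ord0 /\ s <> cst ord_max.

Definition has_admissible {R : realType} {d : nat} (a : 'rV[R]_d.+1) (beta : R)
  : Prop := exists2 s, nontrivial s & admissible a beta s.

Lemma Delta_le (R : realType) (d : nat) (a : 'rV[R]_d.+1) (i j : 'I_d.+1) :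
  Delta a -> (i <= j)%N -> a ord0 i <= a ord0 j.
Proof.
move=> Da; rewrite leq_eqVlt => /orP[/eqP/val_inj->//|ij].
exact/ltW/Da.
Qed.

Lemma Delta_ge0 (R : realType) (d : nat) (a : 'rV[R]_d.+1) (i : 'I_d.+1) :
  Delta a -> a ord0 ord0 <= a ord0 i.
Proof. by move=> Da; exact: Delta_le. Qed.

Lemma Delta_le_max (R : realType) (d : nat) (a : 'rV[R]_d.+1) (i : 'I_d.+1) :
  Delta a -> a ord0 i <= a ord0 ord_max.
Proof. by move=> Da; apply: Delta_le => //; exact: leq_ord. Qed.

Lemma Delta_inj (R : realType) (d : nat) (a : 'rV[R]_d.+1) :
  Delta a -> injective (a ord0).
Proof.
move=> Da i j aij; apply: val_inj; case: (ltngtP i j) => // /Da.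
  by rewrite aij ltxx.
by rewrite aij ltxx.
Qed.

Lemma bounded_digits (R : realType) (d : nat) (a : 'rV[R]_d.+1)
  (s : nat -> 'I_d.+1) : bounded_seq (digits a s).
Proof.
exists (\sum_i `|a ord0 i|) => k.
by rewrite /digits (bigD1 (s k))//= lerDl sumr_ge0.
Qed.

Lemma bounded_tail_digits (R : realType) (d : nat) (a : 'rV[R]_d.+1)
  (s : nat -> 'I_d.+1) n : bounded_seq (tail n (digits a s)).
Proof. exact/bounded_seq_tail/bounded_digits. Qed.

#[local] Hint Resolve bounded_digits bounded_tail_digits bounded_seq_cst : core.

Lemma bsum_digits_ge (R : realType) (d : nat) (a : 'rV[R]_d.+1) (beta : R)
  (s : nat -> 'I_d.+1) : Delta a -> 1 < beta ->
  a ord0 ord0 / (beta - 1) <= bsum beta (digits a s).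
Proof.
by move=> Da b1; rewrite -bsum_cst//; apply: ler_bsum2 => // k; exact: Delta_ge0.
Qed.

Lemma bsum_digits_le (R : realType) (d : nat) (a : 'rV[R]_d.+1) (beta : R)
  (s : nat -> 'I_d.+1) : Delta a -> 1 < beta ->
  bsum beta (digits a s) <= a ord0 ord_max / (beta - 1).
Proof.
by move=> Da b1; rewrite -bsum_cst//; apply: ler_bsum2 => // k; exact: Delta_le_max.
Qed.

(** * Expansions, uniqueness and admissibility *)

Lemma expansionsP (R : realType) (d : nat) (a : 'rV[R]_d.+1) (beta x : R)
    (u : nat -> R) : 1 < beta ->
  expansions beta (alphabet a) x u <->
  exists2 s, u = digits a s & bsum beta (digits a s) = x.
Proof.
move=> b1; split=> [[Au ux]|[s -> <-]].
  have /choice[s su] : forall k, exists i, a ord0 i = u k.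
    by move=> k; have [i _ <-] := Au k; exists i.
  have us : u = digits a s by apply/funext => k; rewrite /digits su.
  by exists s => //; rewrite -us; apply/cvg_lim.
split; first by move=> k; exists (s k).
exact: cvg_bsum.
Qed.

(** Common leading digits cancel one at a time through [bsum_rec]. *)
Lemma eq_bsum_tail (R : realType) (beta : R) (v w : nat -> R) n :
  1 < beta -> bounded_seq v -> bounded_seq w ->
  (forall i, (i < n)%N -> v i = w i) ->
  bsum beta v = bsum beta w <-> bsum beta (tail n v) = bsum beta (tail n w).
Proof.
move=> b1 bv bw; elim: n => [//|n IHn vw].
have {IHn} -> : bsum beta v = bsum beta w <->
    bsum beta (tail n v) = bsum beta (tail n w).
  by apply: IHn => i ni; apply: vw; rewrite ltnS ltnW.
have := bsum_rec n b1 bv; have := bsum_rec n b1 bw.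
rewrite vw// => Ew Ev; split => E.
  by apply: (@addrI _ (w n)); rewrite -Ew -Ev E.
by apply: (@mulfI _ beta); [rewrite gt_eqF//; lra|rewrite Ew Ev E].
Qed.

Lemma first_difference (T : eqType) (s t : nat -> T) : s <> t ->
  exists2 k, s k != t k & forall i, (i < k)%N -> s i = t i.
Proof.
move=> st; have ex : exists k, s k != t k.
  apply: contrapT => nex; apply: st; apply/funext => k.
  by apply/eqP/negPn/negP => skt; apply: nex; exists k.
case: (ex_minnP ex) => k skt min; exists k => // i ik.
by apply/eqP/negPn/negP => /min; rewrite leqNgt ik.
Qed.

(** At the first index where another expansion [t] differs from [s], the two tails differ by exactly
    the gap between the digits. The tail of [t] lies between the extreme values, so the tail of [s]
    would have to violate the admissibility bound. *)
Lemma admissible_univoque (R : realType) (d : nat) (a : 'rV[R]_d.+1) (beta : R)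
    (s : nat -> 'I_d.+1) : Delta a -> 1 < beta ->
  admissible a beta s -> univoque beta (alphabet a) (digits a s).
Proof.
move=> Da b1 adm; exists (bsum beta (digits a s)); apply/seteqP; split; last first.
  by move=> _ ->; apply/expansionsP => //; exists s.
move=> v /(expansionsP _ _ _ b1)[t -> ts] /=; congr (digits a _).
apply: contrapT => /first_difference[k tsk tsi].
have tsE i : (i < k)%N -> digits a t i = digits a s i.
  by move=> /tsi; rewrite /digits => ->.
have E := (eq_bsum_tail b1 (bounded_digits a t) (bounded_digits a s) tsE).1 ts.
have := bsum_rec k b1 (bounded_digits a s).
rewrite -E (bsum_rec k b1 (bounded_digits a t)) /digits => {}E.
have [lo hi] := adm k (t k).
case: (ltngtP (s k) (t k)) => [/[dup] st /lo|/[dup] st /hi|/val_inj st].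
- rewrite bsumB// bsum_cst//.
  have := bsum_digits_ge (fun i => t (k.+1 + i)%N) Da b1.
  rewrite /tail /digits in E *; lra.
- rewrite bsumB// bsum_cst//.
  have := bsum_digits_le (fun i => t (k.+1 + i)%N) Da b1.
  rewrite /tail /digits in E *; lra.
- by rewrite st eqxx in tsk.
Qed.

(** If the bound fails at [k] and [j], replacing [s k] by [j] leaves a remainder still between the
    extreme values. Expanding it and splicing the result in after [j] gives a second expansion of
    the same point. *)
Lemma univoque_admissible (R : realType) (d : nat) (a : 'rV[R]_d.+1) (beta : R)
    (s : nat -> 'I_d.+1) : Delta a -> 1 < beta ->
  (forall y, a ord0 ord0 / (beta - 1) <= y <= a ord0 ord_max / (beta - 1) ->
    exists t, bsum beta (digits a t) = y) ->
  univoque beta (alphabet a) (digits a s) -> admissible a beta s.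
Proof.
move=> Da b1 surj [x uniq] k j.
have [t <- {t} sx] : exists2 t, digits a s = digits a t & bsum beta (digits a t) = x.
  by apply/expansionsP => //; rewrite uniq.
(* Uniqueness forbids a different digit at [k], after the same prefix, from leading to the same
   value. *)
have swap t : t k <> s k -> (forall i, (i < k)%N -> t i = s i) ->
    bsum beta (tail k.+1 (digits a t)) + digits a t k <>
    bsum beta (tail k.+1 (digits a s)) + digits a s k.
  move=> tsk tsi E.
  have tsE i : (i < k)%N -> digits a t i = digits a s i.
    by move=> /tsi; rewrite /digits => ->.
  have /(eq_bsum_tail b1 (bounded_digits a t) (bounded_digits a s) tsE).2 ts :
      bsum beta (tail k (digits a t)) = bsum beta (tail k (digits a s)).
    apply: (@mulfI _ beta); first by rewrite gt_eqF//; lra.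
    by rewrite !bsum_rec// addrC E addrC.
  have : expansions beta (alphabet a) x (digits a t).
    by apply/expansionsP => //; exists t; rewrite // ts.
  by rewrite uniq => /(congr1 (@^~ k))/(Delta_inj Da).
pose splice (r : nat -> 'I_d.+1) i :=
  if (i < k)%N then s i else if i == k then j else r (i - k.+1)%N.
have spliceP r : j != s k ->
    bsum beta (digits a r) <> bsum beta (tail k.+1 (digits a s)) + a ord0 (s k) - a ord0 j.
  move=> jsk E; apply: (swap (splice r)).
  - by rewrite /splice ltnn eqxx; exact/eqP.
  - by move=> i ik; rewrite /splice ik.
  - have -> : tail k.+1 (digits a (splice r)) = digits a r.
      apply/funext => i; rewrite /tail /digits /splice ltnNge ltnW//=; last first.
        by rewrite addSn ltnS leq_addr.
      by rewrite gtn_eqF ?addKn// addSn ltnS leq_addr.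
    by rewrite E /digits /splice ltnn eqxx; lra.
have lo := bsum_digits_ge (fun i => s (k.+1 + i)%N) Da b1.
have hi := bsum_digits_le (fun i => s (k.+1 + i)%N) Da b1.
rewrite !bsumB// !bsum_cst//.
split=> /[dup] sj /Da asj; rewrite ltNge; apply/negP => le.
- have [|r] := surj (bsum beta (tail k.+1 (digits a s)) + a ord0 (s k) - a ord0 j).
    by move: lo hi le; rewrite /tail /digits; lra.
  by apply: spliceP; rewrite -val_eqE gtn_eqF.
- have [|r] := surj (bsum beta (tail k.+1 (digits a s)) + a ord0 (s k) - a ord0 j).
    by move: lo hi le; rewrite /tail /digits; lra.
  by apply: spliceP; rewrite -val_eqE ltn_eqF.
Qed.

(** * Greedy expansions *)

(** The witness is the digit of index [i] followed by a_d forever. Raising its first digit is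
    blocked by the large gap; lowering any digit is blocked because every tail has distance 0 from
    the all-a_d tail. *)
Lemma jump_has_admissible (R : realType) (d : nat) (a : 'rV[R]_d.+1) (beta : R)
    (i : 'I_d.+1) : Delta a -> 1 < beta -> (i < d)%N ->
  (forall j : 'I_d.+1, (i < j)%N ->
    (a ord0 ord_max - a ord0 ord0) / (beta - 1) < a ord0 j - a ord0 i) ->
  has_admissible a beta.
Proof.
move=> Da b1 id gap; pose s k := if k is 0 then i else @ord_max d.
exists s.
  split=> [/(congr1 (@^~ 1%N))/(congr1 val)/= d0|/(congr1 (@^~ 0%N))/(congr1 val)/= d0].
    by have := leq_ltn_trans (leq0n i) id; rewrite lt0n => /eqP.
  by have := id; rewrite ltn_neqAle => /andP[/eqP].
move=> k j; rewrite (_ : tail _ _ = fun=> a ord0 ord_max); last first.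
  by apply/funext.
rewrite /= !bsum_cst// subrr mul0r; split.
  by case: k => [/gap//|k] /=; rewrite ltnNge leq_ord.
by rewrite subr_gt0 => /Da.
Qed.

(** Take the largest digit keeping the remainder above the lower endpoint. If the remainder exceeded
    the upper endpoint, every gap from this digit upwards would be longer than the interval,
    contradicting [jump_has_admissible]. *)
Lemma greedy_digit (R : realType) (d : nat) (a : 'rV[R]_d.+1) (beta y : R) :
  Delta a -> 1 < beta -> ~ has_admissible a beta ->
  a ord0 ord0 / (beta - 1) <= y <= a ord0 ord_max / (beta - 1) ->
  exists i, a ord0 ord0 / (beta - 1) <= beta * y - a ord0 i
            <= a ord0 ord_max / (beta - 1).
Proof.
move=> Da b1 nadm /andP[loy yhi].
have fixpoint c : c / (beta - 1) = beta * (c / (beta - 1)) - c.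
  by field; rewrite subr_eq0 gt_eqF.
have b0 : 0 < beta by lra.
have lo0 : a ord0 ord0 / (beta - 1) <= beta * y - a ord0 ord0.
  by rewrite [leLHS]fixpoint lerD2r ler_pM2l.
have hid : beta * y - a ord0 ord_max <= a ord0 ord_max / (beta - 1).
  by rewrite [leRHS]fixpoint lerD2r ler_pM2l.
case: (@arg_maxnP _ ord0 (fun i => a ord0 ord0 / (beta - 1) <= beta * y - a ord0 i)
  val lo0) => i loi max; exists i; rewrite loi/= leNgt; apply/negP => hii.
apply: nadm; apply: (@jump_has_admissible _ _ _ _ i) => //.
  rewrite ltn_neqAle -ltnS ltn_ord andbT; apply/negP => /eqP id.
  have {}id : i = ord_max by exact: val_inj.
  by move: hii; rewrite id; lra.
move=> j ij; have : beta * y - a ord0 j < a ord0 ord0 / (beta - 1).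
  by rewrite ltNge; apply/negP => /max/=; rewrite leqNgt ij.
rewrite mulrBl; lra.
Qed.

Lemma greedy_expansion (R : realType) (d : nat) (a : 'rV[R]_d.+1) (beta y : R) :
  Delta a -> 1 < beta -> ~ has_admissible a beta ->
  a ord0 ord0 / (beta - 1) <= y <= a ord0 ord_max / (beta - 1) ->
  exists s, bsum beta (digits a s) = y.
Proof.
move=> Da b1 nadm yI; set lo := _ / _ in yI; set hi := _ / _ in yI.
(* The digit chosen outside the interval is arbitrary, since the orbit never leaves it. *)
have /choice[g gP] : forall z, exists i,
    lo <= z <= hi -> lo <= beta * z - a ord0 i <= hi.
  move=> z; have [zI|] := boolP (lo <= z <= hi); last by exists ord0.
  by have [i] := greedy_digit Da b1 nadm zI; exists i.
pose orbit n := iter n (fun z => beta * z - a ord0 (g z)) y.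
have orbitI n : lo <= orbit n <= hi by elim: n => [//|n IHn]; exact: gP.
exists (fun n => g (orbit n)); apply: (@bsum_orbit _ _ _ orbit) => //.
exists (`|lo| + `|hi|) => n; have /andP[] := orbitI n.
have := ler_norm hi; have := ler_norm (- lo); rewrite normrN.
have := normr_ge0 lo; have := normr_ge0 hi.
by rewrite ler_norml => ? ? ? ? ? ?; apply/andP; split; lra.
Qed.

(** * Bounds for bases with a nontrivial admissible sequence *)

(* For [beta <= 4/3] both tails cannot be small at once, so a digit other than
   [a_d] forces [a_0] next and a digit other than [a_0] forces [a_d] next. *)
Lemma has_admissible_gt (R : realType) (d : nat) (a : 'rV[R]_d.+1) (beta : R) :
  (0 < d)%N -> Delta a -> 1 < beta -> has_admissible a beta -> 4 / 3 < beta.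
Proof.
move=> d0 Da b1 [s [s0 sd] adm]; rewrite ltNge; apply/negP => b43.
set p := a ord0 ord0 / (beta - 1); set q := a ord0 ord_max / (beta - 1).
have W0 : a ord0 ord0 < a ord0 ord_max by exact: Da.
have pE : beta * p = a ord0 ord0 + p.
  by rewrite /p; field; rewrite subr_eq0 gt_eqF.
have qE : beta * q = a ord0 ord_max + q.
  by rewrite /q; field; rewrite subr_eq0 gt_eqF.
(* This is where 4/3 enters: it makes 1 / (beta - 1) at least 3. *)
have pq : 3 * (a ord0 ord_max - a ord0 ord0) <= q - p.
  by rewrite -mulrBl ler_pdivlMr ?subr_gt0//; nra.
have adm_lo k : s k != ord_max ->
    bsum beta (tail k.+1 (digits a s)) < p + (a ord0 ord_max - a ord0 ord0).
  move=> sk; have [+ _] := adm k ord_max; rewrite bsumB// bsum_cst// -/p.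
  have -> : (s k < @ord_max d)%N by rewrite ltn_neqAle leq_ord andbT.
  by move=> /(_ isT); have := Delta_ge0 (s k) Da; lra.
have adm_hi k : s k != ord0 ->
    q - (a ord0 ord_max - a ord0 ord0) < bsum beta (tail k.+1 (digits a s)).
  move=> sk; have [_] := adm k ord0; rewrite bsumB// bsum_cst// -/q.
  have -> : (@ord0 d < s k)%N by rewrite lt0n.
  by move=> /(_ isT); have := Delta_le_max (s k) Da; lra.
(* Otherwise [bsum_rec] yields q - p < (1 + beta) (a_d - a_0), and 1 + beta <= 7/3 contradicts
   [pq]. *)
have next0 k : s k != ord_max -> s k.+1 = ord0.
  move=> /adm_lo lo; apply/eqP/negPn/negP => /adm_hi hi.
  have := bsum_rec k.+1 b1 (bounded_digits a s).
  have : a ord0 ord0 <= digits a s k.+1 by exact: Delta_ge0.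
  nra.
have nextd k : s k != ord0 -> s k.+1 = ord_max.
  move=> /adm_hi hi; apply/eqP/negPn/negP => /adm_lo lo.
  have := bsum_rec k.+1 b1 (bounded_digits a s).
  have : digits a s k.+1 <= a ord0 ord_max by exact: Delta_le_max.
  nra.
have od : @ord0 d != ord_max by rewrite -val_eqE/= lt_eqF.
(* An extreme first digit propagates forever; any other would force both a_0 and a_d next. *)
have [s00|s0N0] := eqVneq (s 0%N) ord0.
  by apply: s0; apply/funext; elim=> [//|k IHk]; rewrite next0// IHk.
have [s0d|s0Nd] := eqVneq (s 0%N) ord_max.
  by apply: sd; apply/funext; elim=> [//|k IHk]; rewrite nextd// IHk eq_sym.
by move: od; rewrite -(next0 _ s0Nd) nextd// eqxx.
Qed.

(** The base 2 + r, with r = (a_d - a_0) / (a_1 - a_0), brings (a_d - a_0) / (beta - 1) below the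
    first gap, so a jump at a_0 is available. *)
Lemma has_admissible_large (R : realType) (d : nat) (a : 'rV[R]_d.+1) :
  (0 < d)%N -> Delta a -> exists2 beta, 1 < beta & has_admissible a beta.
Proof.
move=> d0 Da; pose one : 'I_d.+1 := Ordinal (d0 : (1 < d.+1)%N).
have W0 : a ord0 ord0 < a ord0 ord_max by exact: Da.
have a1 : 0 < a ord0 one - a ord0 ord0 by rewrite subr_gt0; exact: Da.
pose r := (a ord0 ord_max - a ord0 ord0) / (a ord0 one - a ord0 ord0).
have rE : r * (a ord0 one - a ord0 ord0) = a ord0 ord_max - a ord0 ord0.
  by rewrite divfK// gt_eqF.
have r0 : 0 <= r by rewrite divr_ge0//; lra.
exists (2 + r); first by lra.
apply: (@jump_has_admissible _ _ _ _ ord0) => //; first by lra.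
move=> j j0; have a1j : a ord0 one <= a ord0 j by exact: Delta_le.
by rewrite ltr_pdivrMr; nra.
Qed.

(** * The univoque set in terms of admissibility *)

Lemma trivial_seqs_digits (R : realType) (d : nat) (a : 'rV[R]_d.+1)
    (s : nat -> 'I_d.+1) : Delta a ->
  trivial_seqs a (digits a s) <-> s = cst ord0 \/ s = cst ord_max.
Proof.
move=> Da; split=> [[] H|[]->]; [left|right|by left|by right].
  by apply/funext => k; apply: (Delta_inj Da); exact: (congr1 (@^~ k) H).
by apply/funext => k; apply: (Delta_inj Da); exact: (congr1 (@^~ k) H).
Qed.

Lemma trivial_admissible (R : realType) (d : nat) (a : 'rV[R]_d.+1) (beta : R)
    (s : nat -> 'I_d.+1) : Delta a -> 1 < beta ->
  s = cst ord0 \/ s = cst ord_max -> admissible a beta s.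
Proof.
move=> Da b1 [] -> k j; rewrite /tail /digits /= !bsum_cst// subrr mul0r.
  by split=> // /(Da ord0 j); rewrite subr_gt0.
split=> [|/(Da j ord_max)]; last by rewrite subr_gt0.
by rewrite ltnNge leq_ord.
Qed.

Lemma has_admissible_univoque (R : realType) (d : nat) (a : 'rV[R]_d.+1)
    (beta : R) : Delta a -> 1 < beta -> has_admissible a beta ->
  exists2 u, univoque beta (alphabet a) u & ~ trivial_seqs a u.
Proof.
move=> Da b1 [s [s0 sd] adm]; exists (digits a s).
  exact: admissible_univoque.
by move=> /(trivial_seqs_digits _ Da)[].
Qed.

(** The greedy algorithm supplies the surjectivity required by [univoque_admissible]; conversely,
    constant extreme sequences are admissible in every base above 1. *)
Lemma univoque_trivial (R : realType) (d : nat) (a : 'rV[R]_d.+1)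
    (beta : R) : Delta a -> 1 < beta -> ~ has_admissible a beta ->
  univoque beta (alphabet a) = trivial_seqs a.
Proof.
move=> Da b1 nadm; apply/seteqP; split => [u uniq|u triv].
  have [x xu] := uniq.
  have /(expansionsP _ _ _ b1)[s us _] : expansions beta (alphabet a) x u.
    by rewrite xu.
  rewrite us in uniq *; apply/trivial_seqs_digits => //.
  apply: contrapT => /not_orP[s0 sd]; apply: (nadm); exists s => //.
  apply: univoque_admissible => // y; exact: greedy_expansion.
have [s us] : exists s, u = digits a s.
  by case: triv => ->; [exists (cst ord0)|exists (cst ord_max)].
rewrite us in triv *; apply: admissible_univoque => //.
apply: trivial_admissible => //; exact: (trivial_seqs_digits s Da).1.
Qed.

(** * Change of alphabet and base *)

(* Here [w] and [v] are offsets of digits in two alphabets: the factor [t ^ 2]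
   in the base pays for the comparison of the two alphabets and still leaves a
   factor [t] to spare. *)
Lemma bsum_rescale (R : realType) (t beta gamma : R) (v w : nat -> R) :
  1 <= t -> 1 < beta -> t ^+ 2 * beta <= gamma ->
  bounded_seq v -> bounded_seq w ->
  (forall k, 0 <= v k) -> (forall k, w k <= t * v k) ->
  t * bsum gamma w <= bsum beta v.
Proof.
move=> t1 b1 tbg bv bw v0 wv.
have t0 : 0 < t by lra.
have b0 : 0 < beta by lra.
have g1 : 1 < gamma.
  by apply: lt_le_trans tbg; rewrite (lt_le_trans b1)// ler_peMl ?exprn_ege1// ltW.
have btv : bounded_seq (fun k => t^-1 * v k).
  have [M Mv] := bv; exists (t^-1 * M) => k.
  by rewrite normrM ger0_norm ?invr_ge0 ?ler_pM2l ?invr_gt0//; lra.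
have : bsum gamma w <= bsum beta (fun k => t^-1 * v k).
  apply: ler_bsum => // k.
  (* Each power of [gamma] gains at least t^2: one factor [t] absorbs [w k <= t * v k], the other
     produces [t^-1]. *)
  have gk : t ^+ 2 * beta ^+ k.+1 <= gamma ^+ k.+1.
    apply: le_trans (_ : (t ^+ 2 * beta) ^+ k.+1 <= _); last first.
      by rewrite lerXn2r// nnegrE ?mulr_ge0 ?exprn_ge0//; lra.
    rewrite exprMn ler_pM2r ?exprn_gt0// -exprM.
    by rewrite ler_weXn2l// mulnS leq_addr.
  apply: (@le_trans _ _ (t * v k * gamma ^- k.+1)).
    by rewrite ler_wpM2r// invr_ge0 exprn_ge0//; lra.
  have -> : t^-1 * v k / beta ^+ k.+1 = t * v k / (t ^+ 2 * beta ^+ k.+1).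
    by field; rewrite !gt_eqF// exprn_gt0.
  rewrite ler_wpM2l ?mulr_ge0//; first lra.
  by rewrite lef_pV2// posrE ?mulr_gt0 ?exprn_gt0//; lra.
by rewrite bsumZ// ler_pdivlMl.
Qed.

(** Gaps are compared because admissibility involves only differences of digits. The symmetry in [a]
    and [b] lets the comparison of golden ratios run both ways. *)
Definition gaps_within {R : realType} {d : nat} (t : R) (a b : 'rV[R]_d.+1)
  : Prop := forall i j : 'I_d.+1, (i < j)%N ->
    b ord0 j - b ord0 i <= t * (a ord0 j - a ord0 i) /\
    a ord0 j - a ord0 i <= t * (b ord0 j - b ord0 i).

(** The same index sequence works: t times the tail sum over [b] is at most the tail sum over [a],
    which is less than the gap in [a], which is at most t times the gap in [b]. *)
Lemma has_admissible_transfer (R : realType) (d : nat) (a b : 'rV[R]_d.+1)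
    (t beta gamma : R) :
  Delta a -> 1 <= t -> 1 < beta -> t ^+ 2 * beta <= gamma ->
  gaps_within t a b ->
  has_admissible a beta -> has_admissible b gamma.
Proof.
move=> Da t1 b1 tbg close [s nts adm]; exists s => // k j.
have t0 : 0 < t by lra.
(* Equal indices are included because tail digits may themselves be extreme. *)
have closeW (i l : 'I_d.+1) : (i <= l)%N ->
    b ord0 l - b ord0 i <= t * (a ord0 l - a ord0 i).
  rewrite leq_eqVlt => /orP[/eqP/val_inj->|/close[]//].
  by rewrite !subrr mulr0.
have [lo hi] := adm k j; split=> [/[dup] sj /lo|/[dup] sj /hi] {}adm_k.
- have [_ gap] := close _ _ sj.
  rewrite -(ltr_pM2l t0); apply: lt_le_trans gap; apply: le_lt_trans adm_k.
  apply: bsum_rescale => //.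
  + exact: bounded_seqB.
  + exact: bounded_seqB.
  + by move=> i; rewrite subr_ge0; exact: Delta_ge0.
  + by move=> i; exact: closeW.
- have [_ gap] := close _ _ sj.
  rewrite -(ltr_pM2l t0); apply: lt_le_trans gap; apply: le_lt_trans adm_k.
  apply: bsum_rescale => //.
  + exact: bounded_seqB.
  + exact: bounded_seqB.
  + by move=> i; rewrite subr_ge0; exact: Delta_le_max.
  + by move=> i; apply: closeW; exact: leq_ord.
Qed.

Lemma has_admissible_mono (R : realType) (d : nat) (a : 'rV[R]_d.+1)
    (beta gamma : R) : Delta a -> 1 < beta -> beta <= gamma ->
  has_admissible a beta -> has_admissible a gamma.
Proof.
move=> Da b1 bg; apply: (@has_admissible_transfer _ _ _ _ 1) => //.
  by rewrite expr1n mul1r.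
by move=> i j _; rewrite mul1r.
Qed.

(** * The golden ratio as an infimum of bases *)

(** The bases in [N] form an upward closed set, and the lower bound 4/3 keeps its infimum above 1.
    This infimum satisfies [is_golden_ratio], and uniqueness then identifies it with the value
    picked by [xget]. *)
Lemma golden_ratioP (R : realType) (d : nat) (a : 'rV[R]_d.+1) :
  (0 < d)%N -> Delta a ->
  [/\ 1 < golden_ratio a,
      forall beta, 1 < beta -> beta < golden_ratio a -> ~ has_admissible a beta
    & forall beta, golden_ratio a < beta -> has_admissible a beta].
Proof.
move=> d0 Da; pose N := [set beta | 1 < beta /\ has_admissible a beta].
have N0 : N !=set0.
  by have [beta b1 Nb] := has_admissible_large d0 Da; exists beta.
have Nlb : lbound N (4 / 3).
  by move=> beta [b1 Nb]; exact/ltW/(has_admissible_gt d0 Da b1).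
have Nlo beta : 1 < beta -> beta < inf N -> ~ has_admissible a beta.
  move=> b1 bN Nb; have : inf N <= beta by apply: ge_inf => //; exists (4 / 3).
  by rewrite leNgt bN.
have Nhi beta : inf N < beta -> has_admissible a beta.
  move=> /(inf_lt N0)[gamma [g1 Ng] gb].
  exact: (has_admissible_mono Da g1 (ltW gb)).
have N1 : 1 < inf N by have := lb_le_inf N0 Nlb; lra.
suff -> : golden_ratio a = inf N by [].
apply: xget_subset1.
  split=> // beta; first by move=> b1 bN; exact: univoque_trivial (Nlo _ b1 bN).
  by move=> bN; apply: has_admissible_univoque (Nhi _ bN); rewrite // (lt_trans N1).
move=> g h [g1 glo ghi] [h1 hlo hhi]; apply/eqP; rewrite eq_le !leNgt.
(* Between two distinct candidates, the midpoint would have both a trivial and a nontrivial univoque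
   set. *)
have contra x y : 1 < x -> x < y ->
    (forall beta, 1 < beta -> beta < y -> univoque beta (alphabet a) = trivial_seqs a) ->
    ~ (forall beta, x < beta ->
        exists2 u, univoque beta (alphabet a) u & ~ trivial_seqs a u).
  move=> x1 xy ylo xhi; have [xm my] := midf_lt xy.
  by have [u] := xhi _ xm; rewrite (ylo _ (lt_trans x1 xm) my).
by apply/andP; split; apply/negP => /contra; [exact|exact].
Qed.

(** Otherwise some [gamma] lies strictly between the two sides; [gamma / t ^+ 2] exceeds the golden
    ratio of [a], and transfer gives an admissible sequence for [b] below its own golden ratio. *)
Lemma golden_ratio_le (R : realType) (d : nat) (a b : 'rV[R]_d.+1) (t : R) :
  (0 < d)%N -> Delta a -> Delta b -> 1 <= t ->
  gaps_within t a b ->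
  golden_ratio b <= t ^+ 2 * golden_ratio a.
Proof.
move=> d0 Da Db t1 close; rewrite leNgt; apply/negP => ltab.
have [a1 _ ahi] := golden_ratioP d0 Da; have [b1 blo _] := golden_ratioP d0 Db.
have [lo hi] := midf_lt ltab; set gamma := (_ + _) / 2 in lo hi.
have t2 : 0 < t ^+ 2 by rewrite exprn_gt0//; lra.
have abeta : golden_ratio a < gamma / t ^+ 2 by rewrite ltr_pdivlMr// mulrC.
have beta1 := lt_trans a1 abeta.
apply: (blo gamma) => //; first by nra.
apply: (has_admissible_transfer Da t1 beta1 _ close); last exact: ahi.
by rewrite mulrC divfK// gt_eqF.
Qed.

(** * Continuity *)

(** Each gap of [a] is positive, hence strictly between 1/t and t times itself; continuity of
    coordinates preserves this nearby, for the finitely many pairs at once. *)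
Lemma near_gaps_within (R : realType) (d : nat) (t : R) (a : 'rV[R]_d.+1) :
  Delta a -> 1 < t -> \forall b \near a, gaps_within t a b.
Proof.
move=> Da t1.
pose close (i j : 'I_d.+1) (b : 'rV[R]_d.+1) := (i < j)%N ->
  b ord0 j - b ord0 i <= t * (a ord0 j - a ord0 i) /\
  a ord0 j - a ord0 i <= t * (b ord0 j - b ord0 i).
suff near_close i j : \forall b \near a, close i j b.
  exact: (filter_forall _ (fun i => filter_forall _ (near_close i))).
have [/Da aij|ji] := ltnP i j; last first.
  by near=> b; rewrite /close ltnNge ji.
have cv : continuous_at a (fun b : 'rV[R]_d.+1 => b ord0 j - b ord0 i).
  by apply: (@cvgB _ _ _ (nbhs a)); exact (@coord_continuous R _ _ ord0 _ a).
near=> b => _; split.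
  by apply/ltW; near: b; apply: (cvgr_lt _ cv); nra.
rewrite -ler_pdivrMl; last by lra.
apply/ltW; near: b; apply: (cvgr_gt _ cv).
by rewrite ltr_pdivrMl; nra.
Unshelve. all: by end_near. Qed.

Theorem theorem1 (R : realType) (d : nat) (hd : (1 <= d)%N) :
  {within @Delta R d, continuous (@golden_ratio R d)}.
Proof.
apply/subspace_continuousP => a Da; apply/cvgrPdist_le => e e0.
have [a1 _ _] := golden_ratioP hd Da; set g := golden_ratio a in a1 *.
have g0 : 0 < g by lra.
(* Since x <= 1, (1 + x)^2 <= 1 + 3x. So with h the nearby value, h - g <= 3xg, whence h <= 4g, and
   g - h <= 3xh <= 12xg <= e. *)
pose x := Num.min 1 (e / (12 * g)).
have x0 : 0 < x by rewrite lt_min ltr01 divr_gt0//; lra.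
have x1 : x <= 1 by rewrite ge_min lexx.
have xg : 12 * (x * g) <= e.
  have : x <= e / (12 * g) by rewrite ge_min lexx orbT.
  by rewrite ler_pdivlMr; lra.
have tx : 1 < 1 + x by lra.
near=> b.
have Db : Delta b by near: b; exact: withinT.
have close : gaps_within (1 + x) a b.
  by near: b; apply: (@filterS _ _ _ _ _ _ (near_gaps_within Da tx)) => c.
have ab : golden_ratio b <= (1 + x) ^+ 2 * g.
  by apply: golden_ratio_le => //; lra.
have ba : g <= (1 + x) ^+ 2 * golden_ratio b.
  apply: golden_ratio_le => //; first lra.
  by move=> i j /close[].
have x2 : x ^+ 2 <= x by rewrite expr2 ler_piMl// ltW.
have [b1 _ _] := golden_ratioP hd Db; set h := golden_ratio b in ab ba b1 *.
have h0 : 0 < h by lra.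
have x2g : x ^+ 2 * g <= x * g by rewrite ler_pM2r.
have x2h : x ^+ 2 * h <= x * h by rewrite ler_pM2r.
have xh : x * h <= x * (4 * g).
  have : x * g <= g by rewrite ler_piMl// ltW.
  by rewrite ler_pM2l//; lra.
by rewrite ler_distlC; change (g - e <= h <= g + e); apply/andP; split; lra.
Unshelve. all: by end_near. Qed.
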